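(* Let $\delta\ge 0$ be an integer. Every strictly polar set-system of degree $\delta$ with a non-MFMC cuboid has a restriction of dimension at most $\delta$ with a non-MFMC cuboid. In particular, if every cuboid of dimension at most $\delta$ with the packing property is MFMC, then every cuboid of degree at most $\delta$ with the packing property is MFMC (i.e., if the replication conjecture holds for all cuboids of dimension at most $\delta$, then it holds for all cuboids of degree at most $\delta$).
   Context: Clutters. A clutter $\mathcal{C}$ over a finite ground set $E$ is a family of subsets of $E$, none of which is contained in another. A cover is a subset of $E$ that intersects every member of $\mathcal{C}$. For $w\in \mathbb{Z}^E_{\ge 0}$, $\tau(\mathcal{C},w)$ is the minimum of $\sum_{e\in B}w_e$ over all covers $B$, and $\nu(\mathcal{C},w)$ is the maximum of $\sum_{C\in\mathcal{C}}y_C$ over all $y\in\mathbb{Z}^{\mathcal{C}}_{\ge 0}$ with $\sum_{C\ni e}y_C\le w_e$ for all $e\in E$ (for the trivial clutter $\{\emptyset\}$ both are $+\infty$ by convention). $\mathcal{C}$ is MFMC if $\tau(\mathcal{C},w)=\nu(\mathcal{C},w)$ for all $w\in \mathbb{Z}^E_{\geq 0}$; it packs if $\tau(\mathcal{C},\mathbf{1})=\nu(\mathcal{C},\mathbf{1})$. For disjoint $I,J\subseteq E$, the minor $\mathcal{C}\setminus I/J$ is the clutter over $E\setminus(I\cup J)$ whose sets are the inclusion-wise minimal sets in $\{C\setminus J: C\in\mathcal{C},\ C\cap I=\emptyset\}$. $\mathcal{C}$ has the packing property if every minor of it (including itself) packs. Set-systems and cuboids. A set-system of dimension $d\ge 1$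 is a subset $S\subseteq\{0,1\}^d$. Its cuboid, $\mathrm{cuboid}(S)$, is the clutter over the ground set $\{i,\bar i:i\in[d]\}$ of $2d$ elements whose members are the sets $\{i:p_i=1\}\cup\{\bar i:p_i=0\}$ for $p\in S$. A cuboid of dimension $d$ is a clutter of this form. For disjoint $I_0,I_1\subseteq[d]$, the restriction of $S$ is the set-system in $\{0,1\}^{[d]\setminus(I_0\cup I_1)}$ obtained from $S\cap\{x: x_i=0\ \forall i\in I_0,\ x_j=1\ \forall j\in I_1\}$ by dropping the coordinates in $I_0\cup I_1$; its dimension is $d-|I_0\cup I_1|$. $S$ is polar if either $S\subseteq\{x:x_i=a\}$ for some $i\in[d]$ and $a\in\{0,1\}$, or $S$ contains points $p,q$ with $p+q=\mathbf{1}$; set-systems of dimension $0$ are considered polar by convention. $S$ is strictly polar if every restriction of $S$ (including $S$ itself) is polar. Let $G_d$ be the graph on vertex set $\{0,1\}^d$ in which two points are adjacent if they differ in exactly one coordinate. $S$, or its cuboid, has degree (at most) $\delta$ if the vertex-induced subgraph $G_d[\{0,1\}^d\setminus S]$ has maximum degree (at most) $\delta$; the maximum degree of the graph with no vertices is taken to be $0$. *)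

(* Defs.v *)
From mathcomp Require Import all_boot.

Set Implicit Arguments.
Unset Strict Implicit.
Unset Printing Implicit Defensive.

Definition antichain (E : finType) (F : {set {set E}}) : bool :=
  [forall A in F, forall B in F, (A \subset B) ==> (A == B)].

Record clutter (E : finType) := Clutter {
  members :> {set {set E}};
  clutter_antichain : antichain members }.

Definition trivial_clutter (E : finType) (C : clutter E) : bool :=
  members C == [set set0].

Definition is_cover (E : finType) (C : clutter E) (B : {set E}) : bool :=
  [forall A in members C, A :&: B != set0].

(* [None] stands for +oo. If [C] is not trivial, then [setT] is a cover, as
   the arg min notation requires. *)
Definition tau (E : finType) (C : clutter E) (w : E -> nat) : option nat :=
  if trivial_clutter C then None
  else Some (\sum_(e in [arg min_(B < setT | is_cover C B) \sum_(e in B) w e]) w e).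

Definition packing (E : finType) (C : clutter E) (w : E -> nat)
    (y : {set E} -> nat) : bool :=
  [forall e, \sum_(A in members C | e \in A) y A <= w e].

(* [None] stands for +oo. If [C] is not trivial, every member is nonempty, so
   the values of a packing on members are at most the total weight; the bound
   on [y] only makes the range of the maximum finite (see [nuP]). *)
Definition nu (E : finType) (C : clutter E) (w : E -> nat) : option nat :=
  if trivial_clutter C then None
  else Some (\max_(y : {ffun {set E} -> 'I_(\sum_e w e).+1} |
                     packing C w (fun A => y A)) \sum_(A in members C) y A).

Definition MFMC (E : finType) (C : clutter E) : Prop :=
  forall w : E -> nat, tau C w = nu C w.

Definition packs (E : finType) (C : clutter E) : Prop :=
  tau C (fun _ => 1) = nu C (fun _ => 1).

Lemma nontrivial_set0 (E : finType) (C : clutter E) :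
  ~~ trivial_clutter C -> set0 \notin members C.
Proof.
apply: contra => C0; apply/eqP/setP => A; rewrite inE.
apply/idP/eqP => [CA | -> //].
have /forall_inP/(_ _ C0)/forall_inP/(_ _ CA) := clutter_antichain C.
by rewrite sub0set => /eqP.
Qed.

Lemma tauP (E : finType) (C : clutter E) (w : E -> nat) :
  ~~ trivial_clutter C ->
  exists k, [/\ tau C w = Some k,
    exists2 B, is_cover C B & \sum_(e in B) w e = k &
    forall B, is_cover C B -> k <= \sum_(e in B) w e].
Proof.
move=> ntC; have C0 := nontrivial_set0 ntC.
have covT : is_cover C setT.
  by apply/forall_inP => A CA; rewrite setIT; apply: contraNneq C0 => <-.
rewrite /tau (negPf ntC).
by case: arg_minnP => // B cB minB; eexists; split=> //; exists B.
Qed.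

Lemma nuP (E : finType) (C : clutter E) (w : E -> nat) :
  ~~ trivial_clutter C ->
  exists k, [/\ nu C w = Some k,
    exists2 y : {set E} -> nat, packing C w y & \sum_(A in members C) y A = k &
    forall y : {set E} -> nat, packing C w y -> \sum_(A in members C) y A <= k].
Proof.
move=> ntC; have C0 := nontrivial_set0 ntC.
rewrite /nu (negPf ntC); eexists; split=> [//||y py].
  set P := fun y : {ffun {set E} -> 'I_(\sum_e w e).+1} =>
    packing C w (fun A => y A).
  have P0 : 0 < #|P|.
    apply/card_gt0P; exists [ffun=> ord0]; rewrite unfold_in.
    by apply/forallP => e; rewrite big1 // => A _; rewrite ffunE.
  have [y Py ->] := eq_bigmax_cond
    (fun y : {ffun {set E} -> 'I_(\sum_e w e).+1} => \sum_(A in members C) y A)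
    P0.
  by exists (fun A => nat_of_ord (y A)).
have leN A : A \in members C -> y A < (\sum_e w e).+1.
  move=> CA; have [A0 | [e Ae]] := set_0Vmem A.
    by rewrite A0 (negPf C0) in CA.
  rewrite ltnS; apply: leq_trans (leq_trans (forallP py e) _).
    by rewrite (bigD1 A) ?CA //= leq_addr.
  by rewrite (bigD1 e) //= leq_addr.
pose z := [ffun A => inord (y A) : 'I_(\sum_e w e).+1].
have zE A : A \in members C -> z A = y A :> nat.
  by move=> CA; rewrite ffunE inordK ?leN.
rewrite -(eq_bigr _ zE).
apply: (leq_bigmax_cond (F := fun y : {ffun {set E} -> 'I_(\sum_e w e).+1} =>
  \sum_(A in members C) y A)).
apply/forallP => e; apply: leq_trans (forallP py e).
by apply/eq_leq/eq_bigr => A /andP[/zE].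
Qed.

(* The sets [A :\: J] of the definition of C \ I / J, as sets over the
   remaining elements, before taking the minimal ones. *)
Definition minor_traces (E : finType) (C : clutter E) (I J : {set E}) :
    {set {set {e : E | e \notin I :|: J}}} :=
  [set val @^-1: (A :\: J) | A in members C & [disjoint A & I]].

Definition minor_members (E : finType) (C : clutter E) (I J : {set E}) :
    {set {set {e : E | e \notin I :|: J}}} :=
  [set B | minset [in minor_traces C I J] B].

Lemma minor_antichain (E : finType) (C : clutter E) (I J : {set E}) :
  antichain (minor_members C I J).
Proof.
apply/forall_inP => A; rewrite inE => /minsetp pA.
apply/forall_inP => B; rewrite inE => /minsetP[_ minB].
by apply/implyP => sAB; rewrite (minB A).
Qed.

Definition minor (E : finType) (C : clutter E) (I J : {set E}) :
    clutter {e : E | e \notin I :|: J} :=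
  Clutter (minor_antichain C I J).

Definition packing_property (E : finType) (C : clutter E) : Prop :=
  forall I J : {set E}, [disjoint I & J] -> packs (minor C I J).

(* Set-systems are indexed by an arbitrary finite type of coordinates, so that
   a restriction is again a set-system, over the remaining coordinates. *)
Notation set_system K := {set {ffun K -> bool}}.

Definition dimension (K : finType) (S : set_system K) : nat := #|K|.

(* [(i, true)] is the element i and [(i, false)] the element i-bar. *)
Definition cuboid_member (K : finType) (p : {ffun K -> bool}) :
    {set K * bool} :=
  [set (i, true) | i in K & p i] :|: [set (i, false) | i in K & ~~ p i].

Lemma in_cuboid_member (K : finType) (p : {ffun K -> bool}) (i : K) (b : bool) :
  ((i, b) \in cuboid_member p) = (p i == b).
Proof.
apply/setUP/eqP => [[]/imsetP[j]|<-].
- by rewrite inE => /andP[_ pj] [-> ->].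
- by rewrite inE => /andP[_ /negPf pj] [-> ->].
case pi: (p i); [left | right]; apply/imsetP; exists i => //;
  by rewrite inE pi.
Qed.

Lemma cuboid_antichain (K : finType) (S : set_system K) :
  antichain [set cuboid_member p | p in S].
Proof.
apply/forall_inP => _ /imsetP[p _ ->]; apply/forall_inP => _ /imsetP[q _ ->].
apply/implyP => /subsetP spq; suff -> : p = q by [].
apply/ffunP => i; apply/esym/eqP.
by rewrite -in_cuboid_member spq ?in_cuboid_member.
Qed.

Definition cuboid (K : finType) (S : set_system K) : clutter (K * bool)%type :=
  Clutter (cuboid_antichain S).

Definition restriction (K : finType) (S : set_system K) (I0 I1 : {set K}) :
    set_system {i : K | i \notin I0 :|: I1} :=
  [set [ffun i => p (val i)] | p : {ffun K -> bool} in S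
     & [forall i in I0, p i == false] && [forall j in I1, p j == true]].

Lemma dimension_restriction (K : finType) (S : set_system K) (I0 I1 : {set K}) :
  dimension (restriction S I0 I1) = dimension S - #|I0 :|: I1|.
Proof. by rewrite /dimension card_sig -(cardC (mem (I0 :|: I1))) addKn; apply: eq_card. Qed.

Definition polar (K : finType) (S : set_system K) : bool :=
  [|| dimension S == 0,
      [exists i : K, exists a : bool, S \subset [set x : {ffun K -> bool} | x i == a]]
    | [exists p in S, exists q in S, forall i, p i + q i == 1]].

Definition strictly_polar (K : finType) (S : set_system K) : Prop :=
  forall I0 I1 : {set K}, [disjoint I0 & I1] -> polar (restriction S I0 I1).

Definition adjacent (K : finType) (p q : {ffun K -> bool}) : bool :=
  #|[set i | p i != q i]| == 1.

Definition degree (K : finType) (S : set_system K) : nat :=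
  \max_(p in ~: S) #|[set q in ~: S | adjacent p q]|.

(* Main.v *)
Require Import Defs.
From mathcomp Require Import all_boot.
From mathcomp Require Import zify.
From Stdlib Require Import Classical.
Set Implicit Arguments.
Unset Strict Implicit.
Unset Printing Implicit Defensive.

(** The equality of tau and nu for a weight w says that whenever every cover
    weighs at least k, there are k members that together use each element e at
    most w e times ([tau_eq_nuP]). Such a family is built one member at a time,
    by induction on the total weight ([all_packable]): it is enough to find a
    point p of S whose member can be paid for, that is, such that every cover
    still weighs at least k - 1 after the weights of its elements drop by one.

    Where w vanishes, the packing is confined to a face of S on which all
    weights are positive. If this face has dimension at most the degree, its
    cuboid is MFMC by assumption. Otherwise every infeasible point of the face
    has fewer infeasible neighbours than coordinates, hence a feasible
    neighbour ([restriction_neighbour]). For k <= 2 polarity of the face gives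
    p: one of two antipodal points, unless the face lies in a facet, and then
    the weight of an element that no member contains can be lowered to zero.

    For k >= 3 the point p is found in [exists_good]. A cover B without a pair
    of opposite elements is an infeasible subcube, formed by the points that
    hit no element of B, and the member of p meets B in as many elements as p
    has coordinates to change to reach this subcube. Pairs {e, opp e} are
    covers, so w e + w (opp e) >= k. Let x lie in as many infeasible subcubes of
    weight exactly k as possible and, subject to that, let the elements hit by x
    be as heavy as possible. If x is feasible, then p = x works. If not, a
    feasible neighbour p of x is tried, and a cover B is compared with a cover
    B0 of weight k whose subcube contains x. Two conflicts (e in B and opp e in
    B0) make B heavy enough, since each accounts for weight k
    ([two_conflicts]); a single conflict is resolved, which replaces B by a
    cover closer to x ([one_conflict]); and when there is none, each element of
    B that x hits weighs at least k / 2. What survives ([good_or_blocked]) is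
    one configuration: B consists of an element e of weight 1 and of two
    elements on ties, that is, on coordinates that the tight subcubes through x
    leave open and whose two elements weigh k / 2 each.

    The coordinates of ties can be changed freely without spoiling the choice of
    x. If all these choices are blocked, the elements e of the blocking covers
    form a cover, so there are at least k >= 4 of them, as k is even. Each of
    them comes with clauses on pairs of ties; the points that violate a clause
    of e form more than a quarter of the cube, and these sets are disjoint for
    different e: a contradiction.

    For the second half, the packing property amounts to the same min-max
    equality for weights with values 0, 1 and k ([packs_minorP]). It passes to
    faces, and with k = 2 and all weights 1 it yields polarity, so that the
    first half applies. *)

(** * Min-max equality as existence of packings *)

(** Packings are kept as lists of members rather than as multiplicity vectors:
    adding a member is then a cons, and passing to a minor is a map. *)
Definition packable (E : finType) (F : {set {set E}}) (w : E -> nat) (k : nat) :=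
  exists s : seq {set E},
    [/\ {subset s <= F}, size s = k &
        forall e, count (fun A : {set E} => e \in A) s <= w e].

Lemma leq_sum_subset (T : finType) (A B : {set T}) (F : T -> nat) :
  A \subset B -> \sum_(e in A) F e <= \sum_(e in B) F e.
Proof. by move=> AB; rewrite [X in _ <= X](big_setID A) /= (setIidPr AB) leq_addr. Qed.

Lemma count_multiplicity (T : finType) (F P : pred T) (s : seq T) :
  {subset s <= F} -> count P s = \sum_(x | F x && P x) count_mem x s.
Proof.
elim: s => [|a s IHs] sF /=; first by rewrite big1.
rewrite big_split /= -IHs => [|x xs]; last by rewrite sF // inE xs orbT.
congr (_ + _); have Fa : F a by apply: sF; rewrite mem_head.
case Pa: (P a); last first.
  by rewrite big1 // => x /andP[_ Px]; case: eqVneq => // ax; rewrite -ax Pa in Px.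
rewrite (bigD1 a) ?Fa ?Pa //= eqxx big1 // => x /andP[_].
by rewrite eq_sym => /negPf ->.
Qed.

(** Weak duality: each member of the list meets the cover. *)
Lemma packable_le (E : finType) (F : {set {set E}}) w k (B : {set E}) :
  {in F, forall A : {set E}, A :&: B != set0} -> packable F w k ->
  k <= \sum_(e in B) w e.
Proof.
move=> cB [s [sF <- sw]].
apply: leq_trans (leq_sum _ (fun e _ => sw e)).
elim: s sF {sw} => [//|A s IHs] sF.
rewrite /= big_split /= -add1n leq_add //; last first.
  by apply: IHs => C Cs; rewrite sF // inE Cs orbT.
have /set0Pn[e /setIP[eA eB]] := cB _ (sF _ (mem_head _ _)).
by rewrite (bigD1 e) //= eA.
Qed.

Lemma packing_packable (E : finType) (C : clutter E) w y k :
  packing C w y -> k <= \sum_(A in members C) y A -> packable C w k.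
Proof.
move=> /forallP py ky.
pose s := flatten [seq nseq (y A) A | A <- enum (members C)].
have cnt P : count P s = \sum_(A in members C | P A) y A.
  rewrite count_flatten -map_comp sumnE big_map big_enum /= big_mkcondr.
  apply: eq_bigr => A _ /=; by rewrite count_nseq; case: (P A); rewrite ?mul1n ?mul0n.
exists (take k s); split=> [A /mem_take/flattenP[_ /mapP[B BC ->]]|| e].
- by rewrite mem_nseq => /andP[_ /eqP->]; rewrite mem_enum in BC.
- apply: size_takel; rewrite -(count_predT s) cnt.
  by rewrite (leq_trans ky) // big_mkcondr.
- apply: leq_trans (py e); rewrite -(cnt (fun A : {set E} => e \in A)).
  by rewrite -{2}(cat_take_drop k s) count_cat leq_addr.
Qed.

(** For the trivial clutter both sides hold: tau and nu are infinite, there is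
    no cover, and the empty member can be repeated at no cost. *)
Lemma tau_eq_nuP (E : finType) (C : clutter E) (w : E -> nat) :
  tau C w = nu C w <->
  (forall k, (forall B, is_cover C B -> k <= \sum_(e in B) w e) ->
             packable C w k).
Proof.
have [tC|ntC] := boolP (trivial_clutter C).
  split=> [_ k _|]; last by rewrite /tau /nu tC.
  move: tC => /eqP C0.
  exists (nseq k set0); split=> [A||e]; last by rewrite count_nseq inE.
    by rewrite mem_nseq C0 => /andP[_ /eqP->]; rewrite inE.
  by rewrite size_nseq.
have [t [-> [B cB <-] minB]] := tauP w ntC.
have [n [-> [y py <-] maxy]] := nuP w ntC.
split=> [[eq_tn] k /(_ B cB) kB|]; first by apply: packing_packable py _; rewrite -eq_tn.
move=> /(_ _ minB) [s [sC ss sw]]; congr Some.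
apply/eqP; rewrite eqn_leq; apply/andP; split.
  have <- : \sum_(A in members C) count_mem A s = \sum_(e in B) w e.
    rewrite -ss -count_predT (count_multiplicity (F := mem (members C))) //.
    by apply: eq_bigl => A; rewrite andbT.
  apply: maxy; apply/forallP => e.
  by rewrite -(count_multiplicity (fun A : {set E} => e \in A) sC) sw.
apply: (packable_le (F := C)) (packing_packable py (leqnn _)).
by move=> A AC; apply: (forall_inP cB).
Qed.

(** * Covers of a cuboid as infeasible subcubes *)

Section Cube.
Variable K : finType.
Implicit Types (p q x y u : {ffun K -> bool}) (e c l : K * bool).
Implicit Types (B : {set K * bool}) (S : set_system K).

Definition hit p e := p e.1 == e.2.
Definition opp e : K * bool := (e.1, ~~ e.2).
Definition flip p i : {ffun K -> bool} := [ffun j => p j (+) (j == i)].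
(** The points that hit no element of [B] form a subcube (if [B] is
    [consistent]), and [B] is a cover when that subcube is disjoint from [S]. *)
Definition point_cover S B := [forall p in S, [exists e in B, hit p e]].
Definition consistent B := [forall e in B, opp e \notin B].
Definition weight (w : K * bool -> nat) B := \sum_(e in B) w e.
(** For consistent [B], the Hamming distance from [p] to the subcube of [B]. *)
Definition hits p B := \sum_(e in B) hit p e.

Lemma point_coverP S B :
  reflect (forall p, p \in S -> exists2 e, e \in B & hit p e) (point_cover S B).
Proof.
apply: (iffP forall_inP) => H p pS; first by have /exists_inP := H p pS.
by apply/exists_inP; apply: H.
Qed.

Lemma hit_opp p e : hit p (opp e) = ~~ hit p e.
Proof. by rewrite /hit /=; case: (p _) e.2 => [] []. Qed.

Lemma hit_flip p i e : hit (flip p i) e = hit p e (+) (e.1 == i).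
Proof. by rewrite /hit ffunE; case: (p _) (_ == i) e.2 => [] [] []. Qed.

Lemma oppK : involutive opp.
Proof. by case=> i b; rewrite /opp /= negbK. Qed.

Lemma opp_neq e : opp e != e.
Proof. by case: e => i b; rewrite /opp xpair_eqE /= eqxx; case: b. Qed.

Lemma eq_coord e e' : (e.1 == e'.1) = (e == e') || (e == opp e').
Proof.
case: e e' => [i b] [j c]; rewrite /opp !xpair_eqE /=.
by case: (i == j) b c => [] [] [].
Qed.

Lemma hit_coord p e : hit p e -> e = (e.1, p e.1).
Proof. by case: e => i b /eqP /= ->. Qed.

Lemma nhit_coord p e : ~~ hit p e -> e = (e.1, ~~ p e.1).
Proof. by rewrite -hit_opp => /hit_coord; case: e => i b /= [<-]; rewrite negbK. Qed.

Lemma sum_point (T : finType) (a : T) (F : T -> nat) :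
  \sum_e (e == a) * F e = F a.
Proof. by rewrite (bigD1 a) //= eqxx mul1n big1 ?addn0 // => e /negPf ->. Qed.

Lemma sum_set (T : finType) (B : {set T}) (F : T -> nat) :
  \sum_(e in B) F e = \sum_e (e \in B) * F e.
Proof. by rewrite big_mkcond; apply: eq_bigr => e _; case: (_ \in _); rewrite ?mul1n. Qed.

(** Flipping the coordinate of an element [e] missed by [x] makes [e] hit and
    [opp e] missed, and changes nothing else. *)
Lemma hits_flip x e B : ~~ hit x e ->
  hits (flip x e.1) B + (opp e \in B) = hits x B + (e \in B).
Proof.
move=> xe; rewrite /hits !sum_set.
rewrite -[X in _ + X = _](sum_point (opp e) (fun c => c \in B : nat)).
rewrite -[X in _ = _ + X](sum_point e (fun c => c \in B : nat)).
rewrite -!big_split; apply: eq_bigr => c _ /=; rewrite hit_flip eq_coord.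
have [->|ne] := eqVneq c e.
  by rewrite (negPf xe) eq_sym (negPf (opp_neq e)); case: (_ \in _).
have [->|_] := eqVneq c (opp e); last by rewrite addbF !mul0n.
by rewrite hit_opp xe; case: (_ \in _).
Qed.

(** A point is determined by its values at [f] and [g] and by the point obtained
    from it by overwriting these two values. *)
Lemma card_codim2_subcube (f g : K) (a b : bool) : f != g ->
  #|{ffun K -> bool}| <= 4 * #|[set u : {ffun K -> bool} | (u f == a) && (u g == b)]|.
Proof.
move=> fg; set N := [set u | _].
pose h (u : {ffun K -> bool}) :=
  ([ffun j => if j == f then a else if j == g then b else u j] : {ffun K -> bool}, (u f, u g)).
have inj_h : injective h.
  move=> u u' [/ffunP E ef eg]; apply/ffunP => j; have := E j; rewrite !ffunE.
  by case: eqVneq => [->//|_]; case: eqVneq => [->|].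
rewrite -cardsT -(card_imset _ inj_h).
apply: (@leq_trans #|setX N [set: bool * bool]|).
  apply/subset_leq_card/subsetP => _ /imsetP[u _ ->]; rewrite !inE !ffunE !eqxx /=.
  by rewrite [g == f]eq_sym (negPf fg) eqxx.
by rewrite cardsX cardsT card_prod card_bool mulnC.
Qed.

End Cube.

(** * A point that meets every cover sparingly *)

Section Step.
Variables (K : finType) (S : set_system K) (w : K * bool -> nat) (k : nat).
Hypotheses (w_gt0 : forall e, 0 < w e) (k_gt2 : 2 < k).
Hypothesis cover_le : forall B, point_cover S B -> k <= weight w B.
Hypothesis neighbour : forall x, x \notin S -> exists i, flip x i \in S.
Implicit Types (p q x y u : {ffun K -> bool}) (e c l : K * bool).
Implicit Types (B : {set K * bool}).

Lemma pair_weight_ge e : k <= w e + w (opp e).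
Proof.
have /cover_le : point_cover S [set e; opp e].
  apply/point_coverP => p _; have [pe|pe] := boolP (hit p e).
    by exists e; rewrite ?set21.
  by exists (opp e); rewrite ?set22 ?hit_opp.
by rewrite /weight big_setU1 ?big_set1 // inE eq_sym opp_neq.
Qed.

(** The tight covers whose infeasible subcube contains [x]. *)
Definition tight_avoided x : {set {set K * bool}} :=
  [set B | [&& point_cover S B, weight w B == k & [forall e in B, ~~ hit x e]]].

Lemma tight_avoidedP x B :
  reflect [/\ point_cover S B, weight w B = k & forall e, e \in B -> ~~ hit x e]
          (B \in tight_avoided x).
Proof.
rewrite inE; apply: (iffP and3P) => [[cB /eqP wB /forall_inP aB] | [cB wB aB]] //.
by split=> //; [apply/eqP | apply/forall_inP].
Qed.

Definition mass x := \sum_i w (i, x i).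

(** Lexicographic maximality: first the number of infeasible subcubes of weight
    [k] through [x], then the weight of the elements hit by [x]. *)
Definition best x :=
  (forall y, #|tight_avoided y| <= #|tight_avoided x|) /\
  (forall y, tight_avoided x = tight_avoided y -> mass y <= mass x).

Lemma best_exists : exists x, best x.
Proof.
have [x _ maxx] := arg_maxnP (fun x => #|tight_avoided x|) (isT : xpredT [ffun=> false]).
have [y /eqP xy maxy] :=
  arg_maxnP (P := fun y => tight_avoided x == tight_avoided y) mass (eqxx _).
exists y; split=> [z|z yz]; first by rewrite -xy; apply: maxx.
by apply: maxy; rewrite xy yz.
Qed.

Lemma best_avoided x y : best x -> tight_avoided x \subset tight_avoided y ->
  tight_avoided x = tight_avoided y.
Proof. by move=> [maxx _] xy; apply/eqP; rewrite eqEcard xy maxx. Qed.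

(** The coordinate of an element [e] hit by [x] can be flipped within the
    intersection of the tight infeasible subcubes through [x]. *)
Definition free x e := forall B, B \in tight_avoided x -> opp e \notin B.

(** Flipping the coordinate of [e] stays in the same tight subcubes, so it cannot
    increase the weight of the elements hit. *)
Lemma free_heavy x e : best x -> hit x e -> free x e -> w (opp e) <= w e.
Proof.
move=> bx xe fe; have sub : tight_avoided x \subset tight_avoided (flip x e.1).
  apply/subsetP => B BT; have /tight_avoidedP[cB wB aB] := BT.
  apply/tight_avoidedP; split=> // c cB'; rewrite hit_flip eq_coord.
  have xc := aB _ cB'; rewrite (negPf xc) /=.
  apply/norP; split; first by apply: contraNneq xc => ->.
  by apply: contraNneq (fe _ BT) => <-.
have := bx.2 _ (best_avoided bx sub).
rewrite /mass (bigD1 e.1) //= [X in _ <= X](bigD1 e.1) //=.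
rewrite (eq_bigr (fun i => w (i, x i))) => [|i /negPf ie]; last by rewrite ffunE ie addbF.
by rewrite leq_add2r ffunE eqxx addbT /opp (eqP xe); case: (e).
Qed.

Lemma free_half x e : best x -> hit x e -> free x e -> uphalf k <= w e.
Proof. by move=> bx xe fe; have := free_heavy bx xe fe; have := pair_weight_ge e; lia. Qed.

(** Flipping all coordinates at which [x] hits [B] leads into the subcube of [B]
    without leaving any tight subcube through [x]; if there was anything to
    flip, [B] would be a tight cover gained. *)
Lemma tight_free_hits x B : best x -> consistent B -> point_cover S B -> weight w B = k ->
  {in B, forall e, hit x e -> free x e} -> hits x B = 0.
Proof.
move=> bx /forall_inP kB cB wB fB.
pose y : {ffun K -> bool} := [ffun j => x j (+) ((j, x j) \in B)].
have sub : tight_avoided x \subset tight_avoided y.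
  apply/subsetP => B0 B0T; have /tight_avoidedP[cB0 wB0 aB0] := B0T.
  apply/tight_avoidedP; split=> // e eB0; have xe := aB0 _ eB0.
  rewrite /hit ffunE; case eB: (_ \in B); last by rewrite addbF.
  have := fB _ eB; rewrite /hit /= eqxx => /(_ isT _ B0T).
  by rewrite /opp /= -(nhit_coord xe) eB0.
have : B \in tight_avoided y.
  apply/tight_avoidedP; split=> // e eB; rewrite /hit ffunE.
  have [xe|xe] := boolP (hit x e).
    by rewrite -(hit_coord xe) eB addbT (eqP xe); case: e.2.
  have -> : (e.1, x e.1) = opp e by rewrite {3}(nhit_coord xe) /opp /= negbK.
  by rewrite (negPf (kB _ eB)) addbF.
rewrite -(best_avoided bx sub) => /tight_avoidedP[_ _ aB].
by apply: big1 => e eB; rewrite (negPf (aB _ eB)).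
Qed.

(** After one unit is taken from each element of the member of [p], every
    consistent cover still weighs at least [k - 1]. *)
Definition good p := [forall B, consistent B && point_cover S B ==>
  (hits p B + k <= weight w B + 1)].

Lemma goodP p : reflect
  (forall B, consistent B -> point_cover S B -> hits p B + k <= weight w B + 1) (good p).
Proof.
apply: (iffP forallP) => [H B kB cB | H B].
  by have /implyP := H B; apply; rewrite kB.
by apply/implyP => /andP[]; apply: H.
Qed.

Lemma weight_half x B : best x -> {in B, forall e, hit x e -> free x e} ->
  uphalf k * hits x B <= weight w B.
Proof.
move=> bx fB; rewrite /hits /weight big_distrr; apply: leq_sum => e eB /=.
case xe: (hit x e); rewrite ?muln0 // muln1; exact: free_half bx xe (fB _ eB xe).
Qed.

(** Through a feasible [x] there is no tight infeasible subcube, so by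
    maximality there is none at all, and every element is free. *)
Lemma best_feasible_good x : best x -> x \in S -> good x.
Proof.
move=> bx xS; apply/goodP => B kB cB.
have fB : {in B, forall e, hit x e -> free x e}.
  move=> e _ _ B0 /tight_avoidedP[/point_coverP/(_ _ xS)[c cB0 xc] _ /(_ _ cB0)].
  by rewrite xc.
have := weight_half bx fB; have := cover_le cB.
have [wB|] := eqVneq (weight w B) k; last first.
  by move: (hits x B) (weight w B) => s W; case: s => [|[|s]]; nia.
by rewrite (tight_free_hits bx kB cB wB fB) wB; lia.
Qed.

Section Neighbour.
Variables (x : {ffun K -> bool}) (i : K).
Hypotheses (bx : best x) (iS : flip x i \in S).
Let e0 : K * bool := (i, ~~ x i).

Let xe0 : hit x e0 = false.
Proof. by rewrite /hit /=; case: (x i). Qed.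

(** The subcube of [B0] contains [x] but not its feasible neighbour, so the flipped
    coordinate is one of those fixed by [B0]. *)
Lemma avoided_e0 B0 : B0 \in tight_avoided x -> e0 \in B0.
Proof.
case/tight_avoidedP=> /point_coverP/(_ _ iS)[e eB0]; rewrite hit_flip => + _ aB0.
rewrite (negPf (aB0 _ eB0)) /= => /eqP ei.
by rewrite /e0 -ei -(nhit_coord (aB0 _ eB0)).
Qed.

(** Each of the [m] conflicts contributes [k] to [weight w B0 + weight w B], whose
    first term is [k]; the remaining hits contribute at least 1 each. What is
    left is [(m - 2) * (k - 1) >= 0]. *)
Lemma two_conflicts B B0 : B0 \in tight_avoided x ->
  1 < #|[set e in B | opp e \in B0]| ->
  hits (flip x i) B + k <= weight w B + 1.
Proof.
move=> B0T m_gt1; have /tight_avoidedP[_ wB0 aB0] := B0T.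
have e0B0 := avoided_e0 B0T.
have E : \sum_(e | opp e \in B0) w (opp e) = k.
  by rewrite -wB0 /weight [RHS](reindex_inj (inv_inj (@oppK K))).
have hf := hits_flip B (negbT xe0); rewrite /= in hf.
have := m_gt1; rewrite -sum1_card sum_set; set m := \sum_e _ => {}m_gt1.
(* The inequality is proved element by element, the two indicator terms being
   charged to e0 and opp e0. *)
suff L : m * k + (hits x B + ((e0 \in B) + (opp e0 \notin B))) <= k + weight w B + m.
  move: hf L; rewrite /opp /=; move: (hits x B) (hits _ B) (weight w B) => a b W.
  by case: (_ \in B); case: (_ \in B); nia.
rewrite -{2}E big_mkcond /= /weight sum_set /hits sum_set /m big_distrl.
rewrite -(sum_point e0 (fun e => e \in B : nat)).
rewrite -(sum_point (opp e0) (fun e => e \notin B : nat)).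
rewrite -!big_split; apply: leq_sum => e _; rewrite /= inE.
have [-> | ne1] := eqVneq e e0.
  rewrite xe0 eq_sym (negPf (opp_neq e0)).
  have -> : opp e0 \in B0 = false by apply/negP => /aB0; rewrite hit_opp xe0.
  by have := w_gt0 e0; case: (e0 \in B) => /=; lia.
have [-> | ne2] := eqVneq e (opp e0).
  rewrite oppK e0B0 hit_opp xe0.
  move: (pair_weight_ge e0) (w_gt0 e0); move: (_ \in B) (w e0) (w (opp e0)); clear.
  by case=> a b /=; lia.
move: (pair_weight_ge e) (w_gt0 e) (w_gt0 (opp e)).
move: (e \in B) (opp e \in B0) (hit x e) (w e) (w (opp e)); clear.
by case=> [] [] [] a b /=; lia.
Qed.

(** The new cover is the resolvent of [B] and [B0] at their only conflict [c]. Its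
    subcube lies closer to [x], because [x] hits no element of [B0], and the two
    covers together outweigh it by [w c + w (opp c) >= k = weight w B0]. *)
Lemma one_conflict B B0 c : consistent B -> point_cover S B -> B0 \in tight_avoided x ->
  c \in B0 -> c != e0 -> opp c \in B -> #|[set e in B | opp e \in B0]| <= 1 ->
  exists B', [/\ consistent B', point_cover S B', hits x B' < hits x B &
    hits (flip x i) B' + k <= weight w B' + 1 ->
    hits (flip x i) B + k <= weight w B + 1].
Proof.
move=> /forall_inP kB cB B0T cB0 ce0 cB' m_le1; have /tight_avoidedP[covB0 wB0 aB0] := B0T.
have e0B0 := avoided_e0 B0T.
have uniq_c e : e \in B -> opp e \in B0 -> e = opp c.
  by move=> eB eB0; apply: (card_le1_eqP m_le1); rewrite inE ?oppK ?eB ?cB'.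
have cB0' : opp c \notin B0 by apply/negP => /aB0; rewrite hit_opp aB0.
have cNB : c \notin B by have := kB _ cB'; rewrite oppK.
have xc : hit x c = false by apply/negbTE/aB0.
pose B' := (B :\ opp c) :|: (B0 :\ c).
have inB' e : (e \in B') = (e != opp c) && (e \in B) || (e != c) && (e \in B0).
  by rewrite !inE.
have ce : e0 == opp c = false by apply: contraNF cB0' => /eqP <-.
exists B'; split.
- apply/forall_inP => e; rewrite !inB' => /orP[] /andP[ne eB].
    apply/norP; split; apply/nandP; right; first exact: kB.
    by apply: contra ne => oeB0; apply/eqP/uniq_c.
  apply/norP; split; apply/nandP; right.
    by apply: contra ne => oeB; apply/eqP/(inv_inj (@oppK K))/uniq_c; rewrite ?oppK.
  by apply/negP => /aB0; rewrite hit_opp aB0.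
- apply/point_coverP => p pS; have [e eB pe] := point_coverP _ _ cB p pS.
  have [e' eB' pe'] := point_coverP _ _ covB0 p pS.
  have [ee|ne] := eqVneq e (opp c); last by exists e; rewrite // inB' ne eB.
  exists e'; rewrite // inB' eB' andbT; apply/orP; right.
  by apply: contraTneq pe' => ->; rewrite -hit_opp -ee.
- rewrite /hits !sum_set -addn1 -[X in _ + X <= _](sum_point (opp c) (fun=> 1)).
  rewrite -big_split; apply: leq_sum => e _; rewrite /= inB'.
  have [->|ne] := eqVneq e (opp c).
    by rewrite /= cB' hit_opp xc (negPf cB0') andbF.
  case xe: (hit x e); last by rewrite !muln0.
  have -> : e \in B0 = false by apply/negP => /aB0; rewrite xe.
  by rewrite andbF orbF addn0.
have hitsE : hits (flip x i) B + (e0 \notin B) <= hits (flip x i) B' + 1.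
  rewrite /hits !sum_set -[X in _ <= _ + X](sum_point (opp c) (fun=> 1)).
  rewrite -[X in _ + X <= _](sum_point e0 (fun e => e \notin B : nat)).
  rewrite -!big_split; apply: leq_sum => e _; rewrite /= inB'.
  have [->|ne] := eqVneq e (opp c).
    apply: leq_trans (leq_addl _ _); rewrite [opp c == e0]eq_sym ce addn0.
    by case: (_ \in B) (hit _ _) => [] [].
  have [->|ne'] := eqVneq e e0; last first.
    by case: (e \in B) (_ && (e \in B0)) (hit _ e) => [] [] [].
  by rewrite [e0 == c]eq_sym ce0 e0B0 hit_flip xe0 eqxx; case: (_ \in B).
have weightE : weight w B' + (e0 \in B) <= weight w B.
  rewrite -(leq_add2r k); apply: leq_trans (leq_add (leqnn _) (pair_weight_ge c)) _.
  rewrite -[X in _ <= _ + X]wB0 addnA /weight !sum_set -[X in X + _ <= _]addnA.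
  rewrite -[X in _ + (X + _) + _ <= _](sum_point e0 (fun e => e \in B : nat)).
  rewrite -[X in _ + (_ + X) + _ <= _](sum_point c w).
  rewrite -[X in _ + X <= _](sum_point (opp c) w).
  rewrite -!big_split; apply: leq_sum => e _; rewrite /= inB'.
  have [->|ne] := eqVneq e (opp c).
    rewrite cB' (negPf cB0') [opp c == e0]eq_sym ce andbF (negPf (opp_neq c)).
    by rewrite !(mul0n, mul1n, addn0, add0n).
  have [ec|ne'] := eqVneq e c.
    by rewrite ec cB0 (negPf cNB) (negPf ce0) !andbF !(mul0n, mul1n, addn0, add0n).
  have [->|_] := eqVneq e e0.
    by rewrite e0B0; move: (w e0) (e0 \in B) (w_gt0 e0); clear => a [] /=; lia.
  by move: (e \in B) (e \in B0) (w e); clear => [] [] [] a /=; lia.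
move: (e0 \in B) (hits _ B) (hits _ B') (weight _ B) (weight _ B') hitsE weightE.
by clear => b h h' W W'; case: b => /=; lia.
Qed.

(** The tight subcubes through [x] leave a tie unconstrained and its two elements
    weigh the same, so changing it keeps a [best] point [best]. *)
Definition tie f := (w (f, true) == w (f, false)) &&
  [forall B in tight_avoided x, ((f, true) \notin B) && ((f, false) \notin B)].

(** The only shape of a cover that can prevent the feasible neighbour [flip x i] from
    being [good]: its weight is [k + 1], which falls short by one. The bound
    [3 < k] records that [k], as the weight of two equally heavy ties, is even. *)
Definition blocked := [exists f, exists g,
  [&& f != g, tie f, tie g, w e0 == 1, 3 < k & point_cover S [set e0; (f, x f); (g, x g)]]].

Lemma free_tie e : hit x e -> free x e -> w (opp e) = w e -> tie e.1.
Proof.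
move=> xe fe we; apply/andP; split.
  by move: we; rewrite /opp; case: (e) => j [] /= ->.
apply/forall_inP => B BT; have oeB := fe _ BT.
have /tight_avoidedP[_ _ aB] := BT.
have eB : e \notin B by apply/negP => /aB; rewrite xe.
by move: oeB eB; rewrite /opp; case: (e) => j [] /= -> ->.
Qed.

(** Each of the two hits weighs at least half of [k] and [e0] at least 1, so a
    total of [k + 1] forces equality everywhere and leaves no further element. *)
Lemma tight_pair_blocked B :
  point_cover S B -> e0 \in B -> weight w B = k.+1 -> hits x B = 2 ->
  {in B, forall e, hit x e -> free x e} -> blocked.
Proof.
move=> cB e0B wB s2 fB.
have /cards2P[e [e' [ee' E]]] : #|[set e in B | hit x e]| == 2.
  apply/eqP; rewrite -s2 /hits -sum1_card !sum_set; apply: eq_bigr => e _.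
  by rewrite inE; case: (_ \in B); case: (hit x e).
have /andP[eB xe] : (e \in B) && hit x e by have := set21 e e'; rewrite -E inE.
have /andP[e'B xe'] : (e' \in B) && hit x e' by have := set22 e e'; rewrite -E inE.
have he := free_half bx xe (fB _ eB xe); have he' := free_half bx xe' (fB _ e'B xe').
have e0e : e0 != e by apply: contraFneq xe0 => ->.
have e0e' : e0 != e' by apply: contraFneq xe0 => ->.
have sumB : weight w B = w e0 + (w e + (w e' + weight w (B :\ e0 :\ e :\ e'))).
  have e1B : e \in B :\ e0 by rewrite !inE eq_sym e0e.
  have e2B : e' \in B :\ e0 :\ e by rewrite !inE eq_sym ee' eq_sym e0e'.
  by rewrite /weight (big_setD1 _ e0B) (big_setD1 _ e1B) (big_setD1 _ e2B).
have w0 := w_gt0 e0.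
have rest0 : B :\ e0 :\ e :\ e' = set0.
  apply/setP => c; rewrite [RHS]inE; apply/negP => cR.
  have : 0 < weight w (B :\ e0 :\ e :\ e').
    by rewrite /weight (big_setD1 c) //= addn_gt0 w_gt0.
  by move: sumB he he' w0; rewrite wB; clear; lia.
have [h0 [h1 h2]] : w e0 = 1 /\ w e = w e' /\ w e + w e' = k.
  by move: sumB he he' w0; rewrite wB /weight rest0 big_set0; clear; lia.
have tie_e c : c \in B -> hit x c -> w c = w e -> tie c.1.
  move=> cB' xc wc; apply: (free_tie xc (fB _ cB' xc)).
  have := pair_weight_ge c; have := free_heavy bx xc (fB _ cB' xc).
  by move: wc h1 h2; clear; lia.
apply/existsP; exists e.1; apply/existsP; exists e'.1.
rewrite h0 eqxx (tie_e e) // (tie_e e') //= -!hit_coord //.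
apply/and3P; split.
- by apply: contraNneq ee' => E1; rewrite (hit_coord xe) (hit_coord xe') E1.
- by move: k_gt2 h1 h2; clear; lia.
- apply/point_coverP => p /(point_coverP _ _ cB)[c cB' pc]; exists c => //.
  have := in_set0 c; rewrite -rest0 !inE cB' andbT.
  by case: (c == e0); case: (c == e); case: (c == e').
Qed.

(** Induction on the number of hits of [x] in [B]. Conflicts with tight covers at
    an element other than [e0] are removed by [two_conflicts] and [one_conflict];
    then all elements of [B] hit by [x], except perhaps [opp e0], are free and
    weigh at least half of [k], and the claim is arithmetic. *)
Lemma good_or_blocked : good (flip x i) || blocked.
Proof.
have [//|nblocked] := boolP blocked; rewrite ?orbT // orbF; apply/goodP => B.
move: {2}(hits x B).+1 (ltnSn (hits x B)) => n.
elim: n B => // n IHn B hn kB cB.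
have [/exists_inP[B0 B0T /exists_inP[c cB0 /andP[ce0 oc]]]|noconf] :=
    boolP [exists B0 in tight_avoided x, [exists c in B0, (c != e0) && (opp c \in B)]].
  have [m_le1|] := leqP #|[set e in B | opp e \in B0]| 1; last exact: two_conflicts.
  have [B' [kB' cB' hB']] := one_conflict kB cB B0T cB0 ce0 oc m_le1.
  by apply; apply: IHn => //; apply: leq_trans hB' _; rewrite -ltnS.
have freeB e : e \in B -> hit x e -> e != opp e0 -> free x e.
  move=> eB xe ne B0 B0T; apply: contra noconf => oeB0.
  apply/exists_inP; exists B0 => //; apply/exists_inP; exists (opp e) => //.
  by rewrite oppK eB andbT; apply: contra ne => /eqP <-; rewrite oppK.
have hf := hits_flip B (negbT xe0); rewrite -/e0 /= in hf.
have wB := cover_le cB; have [oeB|oeB] := boolP (opp e0 \in B).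
  have e0B : e0 \in B = false.
    by apply: contraTF oeB => e0B; apply: (forall_inP kB).
  have : uphalf k * hits x B + 1 <= weight w B + uphalf k.
    rewrite -[X in _ + X <= _](sum_point (opp e0) (fun=> 1)).
    rewrite -[X in _ <= _ + X](sum_point (opp e0) (fun=> uphalf k)).
    rewrite /hits /weight !sum_set big_distrr -!big_split; apply: leq_sum => e _ /=.
    have [->|ne] := eqVneq e (opp e0).
      by rewrite oeB hit_opp xe0 /= !mul1n muln1 addnC leq_add2r.
    case eB: (e \in B); case xe: (hit x e); rewrite ?(mul0n, muln0) //.
    by rewrite !(mul0n, addn0, mul1n, muln1) (free_half bx xe (freeB _ eB xe ne)).
  move: hf wB; rewrite oeB e0B; move: (hits _ _) (hits _ _) (weight _ _) k_gt2; clear.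
  by move=> h s W; case: s => [|[|[|s]]]; nia.
have fB : {in B, forall e, hit x e -> free x e}.
  by move=> e eB xe; apply: freeB => //; apply: contraNneq oeB => <-.
have wh : uphalf k * hits x B + (e0 \in B) <= weight w B.
  rewrite -[X in _ + X <= _](sum_point e0 (fun e => e \in B : nat)).
  rewrite /hits /weight !sum_set big_distrr -!big_split; apply: leq_sum => e _ /=.
  have [->|ne] := eqVneq e e0; first by rewrite xe0 muln0 muln0 mul1n leq_pmulr.
  case eB: (e \in B); case xe: (hit x e); rewrite ?(mul0n, muln0) //.
  by rewrite !(mul0n, addn0, mul1n, muln1) (free_half bx xe (fB _ eB xe)).
have tight0 : weight w B = k -> hits x B = 0 by move=> wBk; apply: tight_free_hits.
have nb : e0 \in B -> weight w B = k.+1 -> hits x B <> 2.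
  by move=> e0B wB1 h2; case/negP: nblocked; apply: tight_pair_blocked fB.
move: hf wB wh tight0 nb; rewrite (negPf oeB).
move: (e0 \in B) (hits _ _) (hits _ _) (weight _ _) k_gt2; clear.
by move=> b h s W; case: b; case: s => [|[|[|s]]]; nia.
Qed.

End Neighbour.

(** If every choice of the ties is blocked, the points of the cube are shared
    among at least four disjoint sets, each larger than a quarter. *)
Lemma exists_good : exists2 p, p \in S & good p.
Proof.
have [/exists_inP//|nogood] := boolP [exists p in S, good p]; exfalso.
have ngood p : p \in S -> good p = false.
  by move=> pS; apply: contraNF nogood => gp; apply/exists_inP; exists p.
have [x0 bx0] := best_exists.
pose T f := tie x0 f.
(* The ties can be set to the values of any u: all these points are best. *)
pose v u : {ffun K -> bool} := [ffun j => if T j then u j else x0 j].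
have avoided_v u : tight_avoided (v u) = tight_avoided x0.
  apply/esym/(best_avoided bx0)/subsetP => B BT.
  have /tight_avoidedP[cB wB aB] := BT; apply/tight_avoidedP; split=> // e eB.
  rewrite /hit ffunE; case: ifP => [/andP[_ /forall_inP/(_ _ BT)]|_]; last exact: aB.
  by move: eB; case: (e) => j [] /= ->; rewrite ?andbF.
have mass_v u : mass (v u) = mass x0.
  apply: eq_bigr => j _; rewrite ffunE; case: ifP => // /andP[/eqP E _].
  by case: (u j) (x0 j) => [] [].
have best_v u : best (v u).
  by split=> y; rewrite avoided_v ?mass_v; [apply: bx0.1 | apply: bx0.2].
have tie_v u : tie (v u) =1 T by move=> f; rewrite /tie avoided_v.
have vNS u : v u \notin S.
  by apply/negP => vS; have := best_feasible_good (best_v u) vS; rewrite ngood.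
have NT u j : flip (v u) j \in S -> ~~ T j.
  apply: contraL => Tj; suff -> : flip (v u) j = v (flip u j) by [].
  apply/ffunP => f; rewrite !ffunE; case: ifP => // nTf.
  by case: eqVneq => [fj|_]; rewrite ?addbF //; move: nTf; rewrite fj Tj.
(* A blocking cover at v u, for the neighbour across e: some clause of e, that
   is, a pair of literals l, l' on ties such that every feasible point that
   misses e satisfies l or l'. *)
pose clause e l l' := [&& T l.1, T l'.1, l.1 != l'.1 & point_cover S [set e; l; l']].
have blockedP u j : flip (v u) j \in S -> [/\ w (j, ~~ x0 j) = 1, 3 < k &
    exists f g, clause (j, ~~ x0 j) (f, u f) (g, u g)].
  move=> jS; have := good_or_blocked (best_v u) jS; rewrite ngood //=.
  case/existsP=> f /existsP[g /and5P[fg]]; rewrite !tie_v => Tf Tg.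
  rewrite !ffunE Tf Tg (negPf (NT _ _ jS)) => /eqP w1 /andP[k3 cS].
  by split=> //; exists f, g; rewrite /clause /= Tf Tg fg.
pose I := [set e | [&& w e == 1, e.2 == ~~ x0 e.1, ~~ T e.1 &
  [exists l, exists l', clause e l l']]].
(* A feasible p satisfies no literal of the clause blocking v (~~ p), since on
   ties this point is opposite to p. Hence p hits the element e itself. *)
have cI : point_cover S I.
  apply/point_coverP => p pS; pose u : {ffun K -> bool} := [ffun j => ~~ p j].
  have [j jS] := neighbour (vNS u); have nTj := NT _ _ jS.
  have [w1 _ [f [g cl]]] := blockedP _ _ jS; exists (j, ~~ x0 j).
    rewrite inE /= w1 !eqxx nTj /=.
    by apply/existsP; exists (f, u f); apply/existsP; exists (g, u g).
  have /and4P[_ _ _ /point_coverP/(_ _ pS)[e + pe]] := cl.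
  rewrite !inE -orbA => /or3P[] /eqP E; first by rewrite -E.
    by move: pe; rewrite E /hit ffunE /=; case: (p f).
  by move: pe; rewrite E /hit ffunE /=; case: (p g).
have I_ge4 : 3 < #|I|.
  have [j jS] := neighbour (vNS x0); have [_ k3 _] := blockedP _ _ jS.
  apply: leq_trans k3 (leq_trans (cover_le cI) _).
  rewrite /weight -sum1_card; apply/eq_leq/eq_bigr => e.
  by rewrite inE => /andP[/eqP].
pose N e := [set u : {ffun K -> bool} |
  [exists l, exists l', [&& clause e l l', ~~ hit u l & ~~ hit u l']]].
(* If u violates a clause of e, the point v u lies in the infeasible subcube of
   the blocking cover, and a feasible neighbour leaves it across e. Hence u
   determines e, and the sets N e are disjoint. *)
have N_flip e u j : e \in I -> u \in N e -> flip (v u) j \in S -> e = (j, ~~ x0 j).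
  move=> + + jS; rewrite !inE => /and4P[_ /eqP e2 nTe _].
  case/existsP=> l /existsP[l' /and3P[/and4P[Tl Tl' _ cS] ul ul']].
  have nTj := NT _ _ jS; have [c] := point_coverP _ _ cS _ jS.
  rewrite hit_flip !inE -orbA => /or3P[] /eqP ->.
  - have [<- _|_] := eqVneq e.1 j; first by rewrite -e2; case: (e).
    by rewrite addbF /hit ffunE (negPf nTe) e2; case: (x0 _).
  - have -> : l.1 == j = false by apply: contraNF nTj => /eqP <-.
    by rewrite addbF /hit ffunE Tl -/(hit u l) (negPf ul).
  - have -> : l'.1 == j = false by apply: contraNF nTj => /eqP <-.
    by rewrite addbF /hit ffunE Tl' -/(hit u l') (negPf ul').
pose M := #|{ffun K -> bool}|.
(* If u violates a clause of e, the clause blocking v u is another clause of e,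
   satisfied by u. Its violators are a quarter of the cube, and u is one more
   element of N e. *)
have N_large e : e \in I -> M < 4 * #|N e|.
  move=> eI; have := eI; rewrite inE => /and4P[_ _ _ /existsP[l /existsP[l' cl]]].
  have /and4P[Tl Tl' ll' _] := cl.
  pose u : {ffun K -> bool} := [ffun j => if j == l.1 then ~~ l.2 else ~~ l'.2].
  have uN : u \in N e.
    rewrite inE; apply/existsP; exists l; apply/existsP; exists l'.
    rewrite cl /hit !ffunE eqxx [l'.1 == _]eq_sym (negPf ll') /=.
    by case: l.2; case: l'.2.
  have [j jS] := neighbour (vNS u); have ej := N_flip _ _ _ eI uN jS.
  have [_ _ [f [g]]] := blockedP _ _ jS; rewrite -ej => cl'.
  have /and4P[_ _ fg _] := cl'.
  apply: leq_ltn_trans (card_codim2_subcube (~~ u f) (~~ u g) fg) _.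
  rewrite ltn_pmul2l //; apply/proper_card/properP; split; last first.
    by exists u; rewrite // inE; case: (u f).
  apply/subsetP => u'; rewrite !inE => /andP[uf ug].
  apply/existsP; exists (f, u f); apply/existsP; exists (g, u g).
  by rewrite cl' /hit /= (eqP uf) (eqP ug); case: (u f); case: (u g).
have : \sum_(e in I) #|N e| <= M.
  under eq_bigr do rewrite -sum1_card big_mkcond.
  rewrite exchange_big /= /M -sum1_card; apply: leq_sum => u _.
  rewrite -big_mkcondr sum1_card; apply/card_le1_eqP => e e' /andP[eI uN] /andP[eI' uN'].
  have [j jS] := neighbour (vNS u).
  by rewrite (N_flip _ _ _ eI uN jS) (N_flip _ _ _ eI' uN' jS).
have : #|I| * M.+1 <= 4 * \sum_(e in I) #|N e|.
  by rewrite -sum_nat_const big_distrr; apply: leq_sum.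
by move: I_ge4; clearbody M; clear; nia.
Qed.
End Step.

(** * Faces of a set-system *)

Definition point_packable (K : finType) (S : set_system K) (w : K * bool -> nat) k :=
  exists s : seq {ffun K -> bool},
    [/\ {subset s <= S}, size s = k &
        forall e, count (fun p => hit p e) s <= w e].

Lemma in_member (K : finType) (p : {ffun K -> bool}) e : (e \in cuboid_member p) = hit p e.
Proof. by case: e => i b; rewrite in_cuboid_member. Qed.

Lemma cuboid_cover (K : finType) (S : set_system K) B :
  is_cover (cuboid S) B = point_cover S B.
Proof.
apply/forall_inP/point_coverP => [H p pS | H A /imsetP[p /H[e eB pe] ->]].
  have /set0Pn[e /setIP[ep eB]] := H _ (imset_f (@cuboid_member K) pS).
  by exists e; rewrite // -in_member.
by apply/set0Pn; exists e; rewrite inE in_member pe.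
Qed.

Lemma cuboid_packable (K : finType) (S : set_system K) w k :
  packable (cuboid S) w k <-> point_packable S w k.
Proof.
split=> [[s [sS <- sw]] | [s [sS <- sw]]].
  pose f (A : {set K * bool}) : {ffun K -> bool} := [ffun i => (i, true) \in A].
  have fK p : f (cuboid_member p) = p.
    by apply/ffunP => i; rewrite ffunE in_member /hit /= eqb_id.
  exists (map f s); split=> [p /mapP[A As ->] || e]; last 1 first.
  - rewrite count_map; apply: leq_trans (sw e); apply/eq_leq/eq_in_count => A As /=.
    by have /imsetP[p _ ->] := sS _ As; rewrite fK in_member.
  - by have /imsetP[q qS ->] := sS _ As; rewrite fK.
  - by rewrite size_map.
exists (map (@cuboid_member K) s); split=> [A /mapP[p ps ->] || e].
- exact/imset_f/sS.
- by rewrite size_map.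
- rewrite count_map; apply: leq_trans (sw e); apply/eq_leq/eq_count => p /=.
  by rewrite in_member.
Qed.

Definition cover_bound (K : finType) (S : set_system K) w k :=
  forall B, point_cover S B -> k <= weight w B.

Lemma cuboid_duality (K : finType) (S : set_system K) w :
  tau (cuboid S) w = nu (cuboid S) w <->
  (forall k, cover_bound S w k -> point_packable S w k).
Proof.
rewrite tau_eq_nuP; split=> H k cb; first apply/cuboid_packable; last apply/cuboid_packable.
  by apply: H => B; rewrite cuboid_cover; apply: cb.
by apply: H => B; rewrite -cuboid_cover; apply: cb.
Qed.

(** Faces are taken along an arbitrary map of coordinates, rather than along a
    subset: restrictions, restrictions of restrictions and renamings of the
    coordinates are all instances. The coordinates outside the image of [phi]
    are fixed to [b]. *)
Definition face (K' K : finType) (phi : K' -> K) (b : K -> bool) (S : set_system K) :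
    set_system K' :=
  [set [ffun i => p (phi i)] | p : {ffun K -> bool} in S &
     [forall j, (j \notin codom phi) ==> (p j == b j)]].

Section Face.
Variables (K' K : finType) (phi : K' -> K) (b : K -> bool) (S : set_system K).
Hypothesis phi_inj : injective phi.
Variables (w' : K' * bool -> nat) (w : K * bool -> nat) (k : nat).
Hypothesis w_phi : forall i a, w (phi i, a) = w' (i, a).

Lemma faceP (p' : {ffun K' -> bool}) : reflect
  (exists p : {ffun K -> bool}, [/\ p \in S, forall i, p (phi i) = p' i &
     forall j, j \notin codom phi -> p j = b j])
  (p' \in face phi b S).
Proof.
apply: (iffP imsetP) => [[p] | [p [pS pp pb]]].
  rewrite inE => /andP[pS /forallP pb] ->; exists p; split=> // [i|j jN].
    by rewrite ffunE.
  by have := pb j; rewrite jN => /eqP.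
exists p; last by apply/ffunP => i; rewrite ffunE pp.
by rewrite inE pS; apply/forallP => j; apply/implyP => /pb ->.
Qed.

Definition lift_elt (e : K' * bool) := (phi e.1, e.2).

Lemma lift_elt_inj : injective lift_elt.
Proof. by case=> i a [j c] [/phi_inj -> ->]. Qed.

Lemma weight_lift (B' : {set K' * bool}) : weight w (lift_elt @: B') = weight w' B'.
Proof.
rewrite /weight big_imset; last by move=> ? ? _ _; apply: lift_elt_inj.
by apply: eq_bigr => -[i a] _; apply: w_phi.
Qed.

Lemma face_hit (p : {ffun K -> bool}) (p' : {ffun K' -> bool}) i a :
  (forall i, p (phi i) = p' i) -> hit p (phi i, a) = hit p' (i, a).
Proof. by move=> pp; rewrite /hit pp. Qed.

(** The elements [(j, ~~ b j)] of weight zero, added to a cover of the face, also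
    meet the points outside the face. *)
Lemma face_cover_bound : (forall j, j \notin codom phi -> w (j, ~~ b j) = 0) ->
  cover_bound S w k -> cover_bound (face phi b S) w' k.
Proof.
move=> w0 cb B' /point_coverP cB'.
pose Z := [set e | (e.1 \notin codom phi) && (e.2 == ~~ b e.1)].
have /cb : point_cover S (lift_elt @: B' :|: Z).
  apply/point_coverP => p pS.
  have [pb|] := boolP [forall j, (j \notin codom phi) ==> (p j == b j)].
    have /cB'[[i a] eB' pe] : [ffun i => p (phi i)] \in face phi b S.
      by apply/imsetP; exists p; rewrite // inE pS.
    exists (phi i, a); first by rewrite inE (imset_f lift_elt eB').
    by rewrite (face_hit (p' := [ffun i => p (phi i)])) // => j; rewrite ffunE.
  rewrite negb_forall => /existsP[j]; rewrite negb_imply => /andP[jN pj].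
  exists (j, ~~ b j); first by rewrite !inE jN eqxx orbT.
  by move: pj; rewrite /hit /=; case: (p j) (b j) => [] [].
move/leq_trans; apply; rewrite -weight_lift /weight.
rewrite (big_setID (lift_elt @: B')) /= setUK [X in _ + X]big1 ?addn0 // => -[j a].
by rewrite !inE => /andP[/negPf ->] /= /andP[jN /eqP ->]; apply: w0.
Qed.

(** A cover either contains some [(j, b j)], which alone is heavy enough, or meets
    the points of the face in its own coordinates. *)
Lemma cover_bound_face : (forall j, j \notin codom phi -> k <= w (j, b j)) ->
  cover_bound (face phi b S) w' k -> cover_bound S w k.
Proof.
move=> wk cb B /point_coverP cB.
have [/exists_inP[[j a] jB /andP[/= jN /eqP ja]]|noB] :=
    boolP [exists e in B, (e.1 \notin codom phi) && (e.2 == b e.1)].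
  apply: leq_trans (wk _ jN) _; rewrite -ja.
  by rewrite /weight (bigD1 (j, a)) //= leq_addr.
have /cb : point_cover (face phi b S) (lift_elt @^-1: B).
  apply/point_coverP => p' /faceP[p [/cB[[j a] eB pe] pp pb]].
  have [/codomP[i ji]|jN] := boolP (j \in codom phi).
    by exists (i, a); rewrite ?inE /lift_elt /= -?ji // -(face_hit _ _ pp) -ji.
  case/exists_inP: noB; exists (j, a) => //=.
  by rewrite jN -(pb _ jN) eq_sym.
move/leq_trans; apply; rewrite -weight_lift /weight leq_sum_subset //.
by apply/subsetP => _ /imsetP[e + ->]; rewrite inE.
Qed.

(** Elements of weight zero keep the packing inside the face. *)
Lemma point_packable_face : (forall j, j \notin codom phi -> w (j, ~~ b j) = 0) ->
  point_packable S w k -> point_packable (face phi b S) w' k.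
Proof.
move=> w0 [s [sS <- sw]].
exists [seq [ffun i => p (phi i)] | p : {ffun K -> bool} <- s].
split=> [_ /mapP[p ps ->] || [i a]]; rewrite ?size_map //.
  apply/imsetP; exists p; rewrite // inE (sS _ ps); apply/forallP => j.
  apply/implyP => jN; have := sw (j, ~~ b j); rewrite (w0 _ jN) leqn0 => /eqP c0.
  have : ~~ has (fun p => hit p (j, ~~ b j)) s by rewrite has_count c0.
  move/hasPn/(_ _ ps); rewrite /hit /=; by case: (p j) (b j) => [] [].
rewrite count_map -w_phi; apply: leq_trans (sw _); apply/eq_leq/eq_count => p /=.
by rewrite /hit ffunE.
Qed.

(** The elements [(j, b j)] lie in every member of the face, so they need weight
    [k]. *)
Lemma face_point_packable : (forall j, j \notin codom phi -> k <= w (j, b j)) ->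
  point_packable (face phi b S) w' k -> point_packable S w k.
Proof.
move=> wk [s' [sS' ss' sw']].
pose P (p' : {ffun K' -> bool}) (p : {ffun K -> bool}) :=
  p' \in face phi b S -> [/\ p \in S, forall i, p (phi i) = p' i &
    forall j, j \notin codom phi -> p j = b j].
have /fin_all_exists[h hP] : forall p', exists p, P p' p.
  move=> p'; have [/faceP[p Pp]|nS] := boolP (p' \in face phi b S); first by exists p.
  by exists [ffun=> false]; rewrite /P (negPf nS).
exists (map h s'); split=> [_ /mapP[p ps ->]||[j a]]; rewrite ?size_map //.
  by have [] := hP _ (sS' _ ps).
rewrite count_map; have [/codomP[i ->]|jN] := boolP (j \in codom phi).
  rewrite w_phi; apply: leq_trans (sw' _); apply/eq_leq/eq_in_count => p' ps /=.
  by have [_ pp _] := hP _ (sS' _ ps); apply: face_hit.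
have [->|ab] := eqVneq a (b j).
  by rewrite (leq_trans (count_size _ _)) // ss' wk.
rewrite (@eq_in_count _ _ pred0) ?count_pred0 // => p' ps /=.
by have [_ _ pb] := hP _ (sS' _ ps); rewrite /hit /= pb // eq_sym (negPf ab).
Qed.

End Face.

Lemma codom_val (K : finType) (I0 I1 : {set K}) j :
  (j \in codom (val : {i : K | i \notin I0 :|: I1} -> K)) = (j \notin I0 :|: I1).
Proof.
apply/codomP/idP => [[i ->]|jN]; first exact: (valP i).
by exists (Sub j jN); rewrite SubK.
Qed.

Lemma restriction_face (K : finType) (S : set_system K) (I0 I1 : {set K}) :
  [disjoint I0 & I1] ->
  restriction S I0 I1 =
  face (val : {i : K | i \notin I0 :|: I1} -> K) (fun j => j \in I1) S.
Proof.
move=> dI; apply/setP => p'.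
have E (p : {ffun K -> bool}) :
    [forall i in I0, p i == false] && [forall j in I1, p j == true] =
    [forall j, (j \notin codom (val : {i : K | i \notin I0 :|: I1} -> K)) ==>
       (p j == (j \in I1))].
  apply/andP/forallP => [[/forall_inP p0 /forall_inP p1] j | H].
    rewrite codom_val negbK; apply/implyP => /setUP[j0|j1].
      by rewrite (eqP (p0 _ j0)) (disjointFr dI j0).
    by rewrite j1 p1.
  split; apply/forall_inP => j jI; have := H j.
    rewrite codom_val negbK inE jI => /eqP ->.
    by rewrite (disjointFr dI jI).
  by rewrite codom_val negbK inE jI orbT.
apply/imsetP/imsetP => -[p + ->]; rewrite inE => /andP[pS pE]; exists p => //.
  by rewrite inE pS -E.
by rewrite inE pS E.
Qed.

(** * Induction on the total weight *)

Lemma flip_adjacent (K : finType) (p : {ffun K -> bool}) i : adjacent p (flip p i).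
Proof.
rewrite /adjacent (_ : [set j | _] = [set i]) ?cards1 //.
by apply/setP => j; rewrite !inE ffunE; case: (j == i) (p j) => [] [].
Qed.

(** Otherwise a lift of [x] to the whole cube would have one infeasible neighbour
    for each coordinate of the restriction, more than the degree allows. *)
Lemma restriction_neighbour (K : finType) (S : set_system K) (I0 I1 : {set K})
    (x : {ffun {i : K | i \notin I0 :|: I1} -> bool}) :
  [disjoint I0 & I1] -> degree S < dimension (restriction S I0 I1) ->
  x \notin restriction S I0 I1 -> exists i, flip x i \in restriction S I0 I1.
Proof.
move=> dI ldeg xN; apply/existsP; apply: contraLR ldeg.
rewrite -leqNgt negb_exists => /forallP noi.
pose y : {ffun K -> bool} := [ffun j => if insub j is Some i then x i else j \in I1].
have liftN (z : {ffun K -> bool}) (z' : {ffun {i : K | i \notin I0 :|: I1} -> bool}) :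
    (forall i, z (val i) = z' i) -> (forall j, j \in I0 :|: I1 -> z j = (j \in I1)) ->
    z' \notin restriction S I0 I1 -> z \in ~: S.
  move=> zz zb; rewrite inE restriction_face //; apply: contra => zS.
  by apply/faceP; exists z; split=> // j; rewrite codom_val negbK; apply: zb.
have yv i : y (val i) = x i by rewrite ffunE valK.
have yb j : j \in I0 :|: I1 -> y j = (j \in I1) by move=> jI; rewrite ffunE insubN ?jI.
have yN : y \in ~: S := liftN _ _ yv yb xN.
apply: leq_trans (leq_bigmax_cond _ yN); rewrite /dimension -cardsT.
have inj : injective (fun i : {i : K | i \notin I0 :|: I1} => flip y (val i)).
  move=> i i' /ffunP/(_ (val i)); rewrite !ffunE eqxx val_eqE; case: eqVneq => // _.
  by case: (if _ is Some _ then _ else _).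
rewrite -(card_imset _ inj); apply/subset_leq_card/subsetP => _ /imsetP[i _ ->].
rewrite inE flip_adjacent andbT; apply: liftN (noi i) => [i'|j jI].
  by rewrite ffunE [RHS]ffunE yv val_eqE.
rewrite ffunE yb // (_ : j == val i = false) ?addbF //.
by apply: contraTF jI => /eqP ->; apply: (valP i).
Qed.

Section OneStep.
Variables (K : finType) (S : set_system K) (w : K * bool -> nat) (k : nat).
Hypotheses (w_gt0 : forall e, 0 < w e) (cb : cover_bound S w k).
Hypothesis neighbour : forall x, x \notin S -> exists i, flip x i \in S.
Hypothesis K_gt0 : 0 < #|K|.

Definition residual (p : {ffun K -> bool}) (e : K * bool) := w e - hit p e.

Lemma weight_residual p B : weight (residual p) B + hits p B = weight w B.
Proof.
rewrite /weight /hits -big_split; apply: eq_bigr => e _ /=; apply: subnK.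
by case: (hit p e); rewrite ?w_gt0.
Qed.

(** An inconsistent cover contains a pair of opposite elements, of which a member
    uses exactly one; hence the pair alone keeps weight at least [k - 1]. *)
Lemma good_cover_bound p :
  (forall B, consistent B -> point_cover S B -> hits p B + k <= weight w B + 1) ->
  cover_bound S (residual p) k.-1.
Proof.
move=> gp B cB; have [kB|] := boolP (consistent B).
  by have := gp _ kB cB; rewrite -(weight_residual p); clear; lia.
rewrite negb_forall => /existsP[e]; rewrite negb_imply negbK => /andP[eB oeB].
have : weight (residual p) [set e; opp e] <= weight (residual p) B.
  by rewrite leq_sum_subset // subUset !sub1set eB.
apply: leq_trans; rewrite /weight big_setU1 ?big_set1; last first.
  by rewrite inE eq_sym opp_neq.
have := pair_weight_ge cb e; have := w_gt0 e; have := w_gt0 (opp e).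
rewrite /residual hit_opp.
by case: (hit p e) => /=; clear; lia.
Qed.

(** For [k <= 2] one of two antipodal points will do: a cover must meet the
    member of the other one, whose elements are left untouched. *)
Lemma step_or_facet : polar S -> 0 < k ->
  (exists2 p, p \in S & cover_bound S (residual p) k.-1) \/
  (exists i a, S \subset [set x : {ffun K -> bool} | x i == a]).
Proof.
move=> + k_gt0; case/or3P=> [/eqP K0|/existsP[i /existsP[a Sia]]|].
- by move: K_gt0; rewrite -[#|K|]/(dimension S) K0.
- by right; exists i, a.
case/exists_inP=> p pS /exists_inP[q qS /forallP pq]; left.
have [k_le2|k_gt2] := leqP k 2; last first.
  have [r rS /goodP gr] := exists_good w_gt0 k_gt2 cb neighbour.
  by exists r => //; apply: good_cover_bound.
exists p => // B cB; have [e eB qe] := point_coverP _ _ cB _ qS.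
apply: (@leq_trans 1); first by move: k_le2; clear; lia.
rewrite /weight (bigD1 e) //= /residual ltn_addr //.
rewrite (_ : hit p e = false) ?subn0 ?w_gt0 //.
by move: (pq e.1) qe; rewrite /hit; case: (p _) (q _) e.2 => [] [] [].
Qed.
End OneStep.

Section Induction.
Variables (K : finType) (S : set_system K).
Hypothesis polarS : strictly_polar S.
Hypothesis small_MFMC : forall I0 I1 : {set K}, [disjoint I0 & I1] ->
  dimension (restriction S I0 I1) <= degree S -> MFMC (cuboid (restriction S I0 I1)).

(** The restriction is determined by the zeros of [w]: where an element has weight
    zero, the points of the packing take the opposite value. Since every pair of
    opposite elements weighs at least [k], a coordinate has at most one zero, and
    then the other element of the pair has weight at least [k]. *)
Lemma all_packable w k : cover_bound S w k -> point_packable S w k.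
Proof.
move: {2}(\sum_e w e).+1 (ltnSn (\sum_e w e)) => n.
elim: n w k => // n IHn w [|k] ltw cb; first by exists [::].
pose I0 := [set i | w (i, true) == 0]; pose I1 := [set i | w (i, false) == 0].
have pair i : k < w (i, true) + w (i, false) by apply: (pair_weight_ge cb (i, true)).
have dI : [disjoint I0 & I1].
  rewrite disjoints_subset; apply/subsetP => i; rewrite !inE => /eqP w0.
  by have := pair i; rewrite w0 -lt0n; case: (w _).
pose b j := j \in I1; pose phi := val : {i : K | i \notin I0 :|: I1} -> K.
pose S' := face phi b S; pose w' e := w (lift_elt phi e).
have rS : restriction S I0 I1 = S' by apply: restriction_face.
have w_phi i a : w (phi i, a) = w' (i, a) by [].
have off0 j : j \notin codom phi -> w (j, ~~ b j) = 0.
  rewrite codom_val negbK inE /b; case j1: (j \in I1).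
    by move: j1; rewrite inE => /eqP.
  by rewrite orbF inE => /eqP.
have offk j : j \notin codom phi -> k < w (j, b j).
  by move/off0 => z; have := pair j; case: (b j) z => /= ->; rewrite ?addn0.
have phi_inj : injective phi by apply: val_inj.
have cb' : cover_bound S' w' k.+1 by apply: face_cover_bound off0 cb.
have [small|large] := leqP (dimension S') (degree S).
  apply: (face_point_packable w_phi offk).
  have : MFMC (cuboid S') by rewrite -rS; apply: small_MFMC; rewrite ?rS.
  by move/(_ w')/cuboid_duality; apply.
have w'_gt0 e : 0 < w' e.
  case: e => i a; have := valP i; rewrite !inE negb_or -!lt0n => /andP[wt wf].
  by rewrite /w' /lift_elt /=; case: a.
have neighbour x : x \notin S' -> exists i, flip x i \in S'.
  by rewrite -rS; apply: restriction_neighbour; rewrite ?rS.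
have K'_gt0 : 0 < dimension S' := leq_ltn_trans (leq0n _) large.
have polS' : polar S' by rewrite -rS; apply: polarS.
have /card_gt0P[i0 _] := K'_gt0.
have [[p' p'S cbp]|[i [a Sia]]] := step_or_facet w'_gt0 cb' neighbour K'_gt0 polS' isT.
  have /faceP[p [pS pp pb]] := p'S.
  have hit_le e : hit p e <= w e.
    case: e => j a; rewrite /hit /=; case: eqVneq => [<-|//].
    have [/codomP[i ->]|jN] := boolP (j \in codom phi).
      exact: w'_gt0 (i, p (phi i)).
    by rewrite pb //; apply: leq_ltn_trans (offk _ jN).
  have : point_packable S (residual w p) k.
    apply: IHn.
      rewrite -ltnS; apply: leq_trans ltw; rewrite ltnS.
      pose e := (phi i0, p (phi i0)).
      rewrite (bigD1 e) //= [X in _ < X](bigD1 e) //= -addSn leq_add //.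
        by rewrite /residual /hit eqxx subn1 prednK //; apply: (w'_gt0 (i0, _)).
      by apply: leq_sum => e' _; apply: leq_subr.
    apply: (@cover_bound_face _ _ phi b S phi_inj _ (residual w p)) cbp => [i a|j jN].
      by rewrite /residual w_phi (face_hit _ _ pp).
    by rewrite /residual; have := offk _ jN; case: (hit _ _); rewrite /=; clear; lia.
  case=> s [sS <- sw]; exists (p :: s); split=> // [q|e].
    by rewrite inE => /orP[/eqP->|/sS].
  by rewrite /= -(subnKC (hit_le e)) leq_add2l.
(* In the facet x i = a the element (i, ~~ a) belongs to no member, so a cover
   does without it and its weight can be dropped. *)
pose w1 e := if e == (phi i, ~~ a) then 0 else w e.
have [] : point_packable S w1 k.+1.
  apply: IHn.
    rewrite -ltnS; apply: leq_trans ltw; rewrite ltnS.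
    rewrite (bigD1 (phi i, ~~ a)) //= [X in _ < X](bigD1 (phi i, ~~ a)) //=.
    rewrite /w1 eqxx -addSn leq_add ?(w'_gt0 (i, ~~ a)) //.
    by apply: leq_sum => e _; case: ifP.
  pose w1' e := w1 (lift_elt phi e).
  apply: (@cover_bound_face _ _ phi b S phi_inj w1' w1) => [//|j jN|B cB].
    rewrite /w1 ifN ?offk //; apply: contraNneq jN => -[-> _]; exact: codom_f.
  have /cb' : point_cover S' (B :\ (i, ~~ a)).
    apply/point_coverP => p pS; have [e eB pe] := point_coverP _ _ cB _ pS; exists e => //.
    rewrite !inE eB andbT; apply: contraTneq pe => ->; rewrite /hit /=.
    by have := subsetP Sia _ pS; rewrite inE => /eqP ->; case: (a).
  move/leq_trans; apply.
  apply: leq_trans (leq_sum_subset _ (subsetDl B [set (i, ~~ a)])).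
  apply: leq_sum => e; rewrite !inE => /andP[ne _].
  by rewrite /w1' /w1 ifN // (inj_eq (lift_elt_inj phi_inj) e (i, ~~ a)).
move=> s [sS ss sw]; exists s; split=> // e; apply: leq_trans (sw e) _.
by rewrite /w1; case: ifP.
Qed.

Lemma MFMC_of_small : MFMC (cuboid S).
Proof. by move=> w; apply/cuboid_duality => k; apply: all_packable. Qed.
End Induction.

(** * Minors as zero-one-infinity weights *)

(** Deleting [I] amounts to weight zero and contracting [J] to infinite weight;
    for packings of size [k] the weight [k] is as good as infinite. *)
Definition minor_weight (E : finType) (I J : {set E}) (k : nat) (e : E) :=
  if e \in I then 0 else if e \in J then k else 1.

Section Minor.
Variables (E : finType) (C : clutter E) (I J : {set E}).
Hypothesis dIJ : [disjoint I & J].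
Notation E' := {e : E | e \notin I :|: J}.
Implicit Types (A B : {set E}) (T : {set E'}).

Definition trace A : {set E'} := val @^-1: (A :\: J).

Lemma in_trace A (e : E') : (e \in trace A) = (val e \in A).
Proof. by have := valP e; rewrite !inE negb_or => /andP[_ ->]. Qed.

Lemma minor_memberP T : T \in minor_members C I J ->
  exists A, [/\ A \in members C, [disjoint A & I] & T = trace A].
Proof.
rewrite inE => /minsetp /imsetP[A]; rewrite inE => /andP[cA AI] ->.
by exists A.
Qed.

Lemma trace_minor A : A \in members C -> [disjoint A & I] ->
  exists2 T, T \in minor_members C I J & T \subset trace A.
Proof.
move=> cA AI; have : trace A \in minor_traces C I J by apply: imset_f; rewrite inE cA.
by move=> /(minset_exists (P := [in minor_traces C I J]))[T mT sT]; exists T; rewrite ?inE.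
Qed.

Lemma outside e : e \notin I -> e \notin J -> exists e' : E', val e' = e.
Proof.
move=> eI eJ; have eN : e \notin I :|: J by rewrite inE negb_or eI.
by exists (Sub e eN).
Qed.

Variable k : nat.
Notation mw := (minor_weight I J k).

Lemma mw_val (e : E') : mw (val e) = 1.
Proof. by have := valP e; rewrite !inE negb_or /minor_weight => /andP[/negPf -> /negPf ->]. Qed.

Lemma sum_mw_val T : \sum_(e in val @: T) mw e = #|T|.
Proof.
rewrite big_imset; last by move=> ? ? _ _; apply: val_inj.
by rewrite -sum1_card; apply: eq_bigr => e _; apply: mw_val.
Qed.

(** A cover of the minor becomes a cover of [C] by adding [I] at no cost; a cover
    of [C] that meets [J] weighs at least [k]. *)
Lemma minor_cover_bound :
  (forall B, is_cover C B -> k <= \sum_(e in B) mw e) <->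
  (forall T, is_cover (minor C I J) T -> k <= \sum_(e in T) 1).
Proof.
split=> cb B /forall_inP cB.
  have /cb : is_cover C (val @: B :|: I).
    apply/forall_inP => A cA; have [AI|] := boolP [disjoint A & I]; last first.
      by rewrite -setI_eq0; apply: contraNneq => AB; rewrite -subset0 -AB setIS ?subsetUr.
    have [T TM sT] := trace_minor cA AI.
    have /set0Pn[e /setIP[eT eB]] := cB _ TM.
    apply/set0Pn; exists (val e).
    by rewrite !inE (imset_f val eB) -in_trace (subsetP sT).
  move/leq_trans; apply; rewrite sum1_card -sum_mw_val.
  rewrite (big_setID (val @: B)) /= setUK [X in _ + X]big1 ?addn0 // => e.
  by rewrite !inE /minor_weight => /andP[/negPf ->] /= ->.
have [/set0Pn[e /setIP[eB eJ]]|/negbNE/eqP BJ] := boolP (B :&: J != set0).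
  by rewrite (bigD1 e) //= /minor_weight eJ (disjointFl dIJ eJ) leq_addr.
have /cb : is_cover (minor C I J) (val @^-1: B).
  apply/forall_inP => _ /minor_memberP[A [cA AI ->]].
  have /set0Pn[e /setIP[eA eB]] := cB _ cA.
  have [||e' ee'] := @outside e; first by rewrite (disjointFr AI eA).
    by apply/negP => eJ; have := in_set0 e; rewrite -BJ inE eB eJ.
  by apply/set0Pn; exists e'; rewrite inE in_trace inE ee' eA.
move/leq_trans; apply; rewrite sum1_card -sum_mw_val leq_sum_subset //.
by apply/subsetP => _ /imsetP[e + ->]; rewrite inE.
Qed.

(** A member of [C] that avoids [I] contains a member of the minor, and a member of
    the minor is what such a set leaves outside [J]. *)
Lemma minor_packable : packable C mw k <-> packable (minor C I J) (fun=> 1) k.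
Proof.
split=> -[s [sC ss sw]].
  have dI A : A \in s -> [disjoint A & I].
    move=> As; rewrite -setI_eq0; apply/eqP/setP => e; rewrite !inE; apply/negP => /andP[eA eI].
    have := sw e; rewrite /minor_weight eI leqn0 => /eqP c0.
    have : ~~ has (fun A : {set E} => e \in A) s by rewrite has_count c0.
    by move/hasPn/(_ _ As); rewrite eA.
  have /fin_all_exists[h hP] : forall A, exists T,
      A \in s -> T \in minor_members C I J /\ T \subset trace A.
    move=> A; have [As|] := boolP (A \in s); last by exists set0.
    by have [T TM sT] := trace_minor (sC _ As) (dI _ As); exists T.
  exists (map h s); split=> [_ /mapP[A As ->]||e]; rewrite ?size_map //.
    by have [] := hP _ As.
  rewrite count_map -(mw_val e); apply: leq_trans (sw _).
  rewrite -!sum1_count big_mkcond [X in _ <= X]big_mkcond /= big_seq [X in _ <= X]big_seq.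
  apply: leq_sum => A As; case: ifP => // eh.
  by have [_ /subsetP/(_ _ eh)] := hP _ As; rewrite in_trace => ->.
have /fin_all_exists[h hP] : forall T, exists A,
    T \in s -> [/\ A \in members C, [disjoint A & I] & T = trace A].
  move=> T; have [Ts|] := boolP (T \in s); last by exists set0.
  by have [A PA] := minor_memberP (sC _ Ts); exists A.
exists (map h s); split=> [_ /mapP[A As ->]||e]; rewrite ?size_map //.
  by have [] := hP _ As.
rewrite count_map; have [eI|eI] := boolP (e \in I).
  rewrite (@eq_in_count _ _ pred0) ?count_pred0 // => A As /=.
  by have [_ AI _] := hP _ As; rewrite (disjointFl AI eI).
have [eJ|eJ] := boolP (e \in J).
  by rewrite /minor_weight (negPf eI) eJ -ss count_size.
have [e' <-] := outside eI eJ; rewrite mw_val; apply: leq_trans (sw e').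
by apply/eq_leq/eq_in_count => T Ts /=; have [_ _ {2}->] := hP _ Ts; rewrite in_trace.
Qed.
End Minor.

Lemma packs_minorP (E : finType) (C : clutter E) (I J : {set E}) : [disjoint I & J] ->
  packs (minor C I J) <->
  (forall k, (forall B, is_cover C B -> k <= \sum_(e in B) minor_weight I J k e) ->
     packable C (minor_weight I J k) k).
Proof.
move=> dIJ; rewrite /packs tau_eq_nuP; split=> H k cb.
  by apply/minor_packable/H/minor_cover_bound.
by apply/minor_packable/H/minor_cover_bound.
Qed.

Lemma packing_propertyP (K : finType) (S : set_system K) :
  packing_property (cuboid S) <->
  (forall (I J : {set K * bool}) k, [disjoint I & J] ->
     cover_bound S (minor_weight I J k) k ->
     point_packable S (minor_weight I J k) k).
Proof.
split=> H I J => [k dIJ cb | dIJ].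
  apply/cuboid_packable; have /(packs_minorP _ dIJ) := H I J dIJ; apply.
  by move=> B; rewrite cuboid_cover; apply: cb.
apply/packs_minorP => // k cb; apply/cuboid_packable/H => // B.
by rewrite -cuboid_cover; apply: cb.
Qed.

(** The face is itself a minor of the cuboid, obtained by deleting [(j, ~~ b j)]
    and contracting [(j, b j)] at each fixed coordinate [j]; so its minors arise
    by enlarging [I] and [J] by these elements. *)
Lemma packing_property_face (K' K : finType) (phi : K' -> K) (b : K -> bool) S :
  injective phi -> packing_property (cuboid S) -> packing_property (cuboid (face phi b S)).
Proof.
move=> phi_inj /packing_propertyP pS; apply/packing_propertyP => I J k dIJ cb.
(* The elements of the fixed coordinates that are deleted (c = true) and
   contracted (c = false). *)
pose Z c := [set e : K * bool | (e.1 \notin codom phi) && (e.2 == (b e.1 (+) c))].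
pose I' := (lift_elt phi @: I) :|: Z true; pose J' := (lift_elt phi @: J) :|: Z false.
have inL (X : {set K' * bool}) c i a :
    ((phi i, a) \in lift_elt phi @: X :|: Z c) = ((i, a) \in X).
  rewrite in_setU [_ \in Z _]inE /= codom_f orbF -[(phi i, a)]/(lift_elt phi (i, a)).
  by rewrite (mem_imset _ _ (lift_elt_inj phi_inj)).
have inZ (X : {set K' * bool}) c j a : j \notin codom phi ->
    ((j, a) \in lift_elt phi @: X :|: Z c) = (a == b j (+) c).
  move=> jN; rewrite in_setU [_ \in Z _]inE /= jN (_ : _ \in _ @: X = false) //.
  by apply: contraNF jN => /imsetP[e _ [-> _]]; apply: codom_f.
have dIJ' : [disjoint I' & J'].
  rewrite -setI_eq0; apply/eqP/setP => -[j a]; rewrite in_setI in_set0.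
  have [/codomP[i ->]|jN] := boolP (j \in codom phi).
    by rewrite !inL -in_setI (eqP (_ : I :&: J == set0)) ?setI_eq0 ?inE.
  by rewrite !inZ //; case: a (b j) => [] [].
have w_phi i a : minor_weight I' J' k (phi i, a) = minor_weight I J k (i, a).
  by rewrite /minor_weight !inL.
have off0 j : j \notin codom phi -> minor_weight I' J' k (j, ~~ b j) = 0.
  by move=> jN; rewrite /minor_weight inZ // addbT eqxx.
have offk j : j \notin codom phi -> k <= minor_weight I' J' k (j, b j).
  by move=> jN; rewrite /minor_weight !inZ // addbT addbF eqxx; case: (b j).
apply: (point_packable_face w_phi off0); apply: pS => //.
exact: (@cover_bound_face _ _ phi b S phi_inj (minor_weight I J k)).
Qed.

(** * From the packing property to strict polarity *)

(** Covers with at most one element correspond to facets containing [S]. Without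
    them there are two members sharing no element, hence two antipodal points. *)
Lemma packing_property_polar (K : finType) (S : set_system K) :
  packing_property (cuboid S) -> polar S.
Proof.
move=> /packing_propertyP pS; have [K0|K_gt0] := posnP #|K|.
  by apply/or3P/Or31; rewrite /dimension K0.
apply/or3P.
have [yes|nofacet] := boolP [exists i : K, exists a : bool,
    S \subset [set x : {ffun K -> bool} | x i == a]].
  by apply: Or32.
apply: Or33; have facet i a : ~~ (S \subset [set x : {ffun K -> bool} | x i == a]).
  by apply: contra nofacet => Sia; apply/existsP; exists i; apply/existsP; exists a.
have /card_gt0P[i0 _] := K_gt0.
have mw e : minor_weight set0 set0 2 e = 1 by rewrite /minor_weight !inE.
have [||s [sS ss sw]] := pS set0 set0 2; first by rewrite -setI_eq0 setI0.
  move=> B cB; rewrite /weight (eq_bigr (fun=> 1)) => [|e _]; last exact: mw.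
  rewrite sum1_card leqNgt ltnS; apply/negP => B1.
  have [B0|[[i a] iB]] := set_0Vmem B.
    case/negP: (facet i0 true); apply/subsetP => p /(point_coverP _ _ cB)[e].
    by rewrite B0 inE.
  case/negP: (facet i a); apply/subsetP => p /(point_coverP _ _ cB)[e eB pe].
  by rewrite inE; move: pe; rewrite (card_le1_eqP B1 _ _ iB eB).
case: s ss sS sw => [|p [|q []]] //= _ sS sw.
apply/exists_inP; exists p; first by apply: sS; rewrite !inE eqxx.
apply/exists_inP; exists q; first by apply: sS; rewrite !inE eqxx orbT.
apply/forallP => i; have := sw (i, true); have := sw (i, false); rewrite !mw /hit /=.
by case: (p i); case: (q i).
Qed.

Lemma packing_property_strictly_polar (K : finType) (S : set_system K) :
  packing_property (cuboid S) -> strictly_polar S.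
Proof.
move=> pS I0 I1 dI; apply: packing_property_polar; rewrite restriction_face //.
by apply: packing_property_face => //; apply: val_inj.
Qed.

(** With [phi] bijective the face is all of [S] under a renaming of coordinates. *)
Lemma MFMC_face (K' K : finType) (phi : K' -> K) (b : K -> bool) (S : set_system K) :
  bijective phi -> MFMC (cuboid (face phi b S)) -> MFMC (cuboid S).
Proof.
move=> bphi mS w; apply/cuboid_duality => k cb.
have phi_inj := bij_inj bphi.
have cod j : j \in codom phi by case: bphi => g _ gK; rewrite -(gK j) codom_f.
have w_phi i a : w (phi i, a) = (w \o lift_elt phi) (i, a) by [].
apply: (face_point_packable w_phi) => [j|]; first by rewrite cod.
have /cuboid_duality := mS (w \o lift_elt phi); apply.
by apply: face_cover_bound cb => // j; rewrite cod.
Qed.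

(** The only possible member is empty, and it can be repeated at will. *)
Lemma MFMC_dim0 (K : finType) (S : set_system K) : #|K| = 0 -> MFMC (cuboid S).
Proof.
move=> K0 w; apply/cuboid_duality => k cb.
have noK (i : K) : False by have := fintype0 i; rewrite K0.
have [S0|[p pS]] := set_0Vmem S.
  have := cb set0; rewrite /weight big_set0 leqn0 => /(_ _)/eqP k0.
  exists [::]; split=> //=; rewrite k0 //; apply/point_coverP => p; by rewrite S0 inE.
exists (nseq k p); split=> [q|| [i a]]; [| exact: size_nseq | by case: (noK i)].
by rewrite mem_nseq => /andP[_ /eqP ->].
Qed.

Theorem theorem4 (delta : nat) :
  (forall (d : nat) (S : set_system 'I_d),
     0 < d -> strictly_polar S -> degree S = delta -> ~ MFMC (cuboid S) ->
     exists I0 I1 : {set 'I_d},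
       [/\ [disjoint I0 & I1],
           dimension (restriction S I0 I1) <= delta &
           ~ MFMC (cuboid (restriction S I0 I1))])
  /\
  ((forall (d : nat) (S : set_system 'I_d),
      0 < d -> d <= delta -> packing_property (cuboid S) -> MFMC (cuboid S)) ->
   forall (d : nat) (S : set_system 'I_d),
     0 < d -> degree S <= delta -> packing_property (cuboid S) ->
     MFMC (cuboid S)).
Proof.
split=> [d S _ polS <- nS | small d S _ ledelta pS].
  apply: NNPP => noI; apply: nS; apply: MFMC_of_small => // I0 I1 dI ldim.
  by apply: NNPP => nM; apply: noI; exists I0, I1.
apply: MFMC_of_small => [|I0 I1 dI ldim]; first exact: packing_property_strictly_polar.
have [K0|K_gt0] := posnP #|{: {i : 'I_d | i \notin I0 :|: I1}}|; first exact: MFMC_dim0.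
apply: (MFMC_face (b := xpredT) (@enum_val_bij _)).
apply: small => //; first exact: leq_trans ldim ledelta.
apply: packing_property_face; first exact: enum_val_inj.
by rewrite restriction_face //; apply: packing_property_face => //; apply: val_inj.
Qed.
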